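(* For any increasing sublinear function $h:\mathbb{R}_+\to\mathbb{R}_+$ and every $1\leq p<\infty$, there exist a nondecreasing function $f:\mathbb{R}_+\to\mathbb{R}_+$ satisfying $$\int_1^{\infty}\left(\frac{f(t)}{t}\right)^p\frac{dt}{t}<\infty,$$ a constant $c>0$ and an increasing sequence of integers $(n_i)_{i\in\mathbb{N}}$ such that $$f(n_i)\geq c\,h(n_i)\quad\text{for all } i\in\mathbb{N}.$$
   Context: A function $h:\mathbb{R}_+\to\mathbb{R}_+$ is sublinear if $h(t)/t\to 0$ as $t\to\infty$. *)

(* Defs.v *)
From HB Require Import structures.
From mathcomp Require Import all_boot all_order all_algebra.
From mathcomp Require Import all_classical all_reals all_analysis.
Set Implicit Arguments.
Unset Strict Implicit.
Unset Printing Implicit Defensive.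
Import Order.TTheory GRing.Theory Num.Theory.
Import numFieldNormedType.Exports.
Local Open Scope classical_set_scope.
Local Open Scope ring_scope.

(* A function R_+ -> R_+ is represented by a function R -> R; only its values
   on [0, +oo[ are ever constrained or used. *)
Definition maps_nonneg (R : realType) (h : R -> R) : Prop :=
  forall t : R, 0 <= t -> 0 <= h t.

Definition increasing_nonneg (R : realType) (h : R -> R) : Prop :=
  forall s t : R, 0 <= s -> s < t -> h s < h t.

Definition nondecreasing_nonneg (R : realType) (f : R -> R) : Prop :=
  forall s t : R, 0 <= s -> s <= t -> f s <= f t.

Definition sublinear (R : realType) (h : R -> R) : Prop :=
  h t / t @[t --> +oo] --> (0 : R).

(* Main.v *)
Require Import Defs.
From HB Require Import structures.
From mathcomp Require Import all_boot all_order all_algebra.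
From mathcomp Require Import all_classical all_reals all_analysis.
From mathcomp Require Import measurable_realfun ring.
Set Implicit Arguments.
Unset Strict Implicit.
Unset Printing Implicit Defensive.
Import Order.TTheory GRing.Theory Num.Theory.
Import numFieldNormedType.Exports.
Local Open Scope classical_set_scope.
Local Open Scope ring_scope.

(* By sublinearity choose n_0 < n_1 < ... with h(n_i) / n_i <= 2^-(i+1), and let
   f(t) be the sum of h(n_i) over all i with n_i <= t; so f(n_i) >= h(n_i). Since
   f(t) / t <= sum_i 2^-(i+1) <= 1, the p-th power is at most f(t) / t, and
   integrating termwise, the integral of f(t) / t^2 is
   sum_i h(n_i) / n_i <= sum_i 2^-(i+1) <= 1. *)

Lemma cvgyV (R : realType) : (x : R)^-1 @[x --> +oo] --> (0 : R).
Proof.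
apply/cvgr0Pnorm_le => e e0; near=> x.
have x0 : 0 < x by near: x; exact: nbhs_pinfty_gt.
rewrite gtr0_norm ?invr_gt0// -(invrK e) lef_pV2 ?posrE ?invr_gt0//.
Unshelve. all: by end_near. Qed.

Lemma measurable_fun_inv (R : realType) (D : set R) :
  measurable D -> D `<=` [set t | 0 < t] ->
  measurable_fun D (fun t : R => t^-1).
Proof.
move=> mD D0; apply: subspace_continuous_measurable_fun => //.
apply: continuous_in_subspaceT => t /set_mem /D0 /= t0.
by apply: inv_continuous; rewrite gt_eqF.
Qed.

Lemma measurable_fun_inv_sqr (R : realType) (D : set R) :
  measurable D -> D `<=` [set t | 0 < t] ->
  measurable_fun D (fun t : R => t ^- 2).
Proof.
move=> mD D0.
have -> : (fun t : R => t ^- 2) = (fun t : R => t^-1 ^+ 2).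
  by apply/funext => t; rewrite exprVn.
by apply: measurable_funX; exact: measurable_fun_inv.
Qed.

Lemma itvcy_pos (R : realType) (a : R) : 0 < a -> `[a, +oo[ `<=` [set t | 0 < t].
Proof. by move=> a0 t /=; rewrite in_itv/= andbT; exact: lt_le_trans. Qed.

(** The antiderivative [- (c / x)] tends to 0 at infinity and equals [- (c / a)] at [a]; the
    fundamental theorem of calculus for improper integrals of nonnegative functions applies. *)
Lemma integral_itvcy_inv_sqr (R : realType) (a c : R) : 0 < a -> 0 <= c ->
  (\int[@lebesgue_measure R]_(t in `[a, +oo[) (c * t ^- 2)%:E = (c / a)%:E)%E.
Proof.
move=> a0 c0.
have dF (x : R) : a < x -> is_derive x 1 (fun x : R => - (c * x^-1)) (c * x ^- 2).
  move=> ax; have x0 : x != 0 by rewrite gt_eqF// (lt_trans a0).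
  have dV : is_derive x 1 (fun x : R => x^-1) (- x ^- 2 *: (1 : R)).
    exact: is_deriveV.
  have -> : c * x ^- 2 = - (c *: (- x ^- 2 *: (1 : R))).
    by rewrite /GRing.scale/= mulr1 mulrN opprK.
  exact: is_deriveN.
rewrite (@ge0_continuous_FTC2y _ _ (fun x : R => - (c * x^-1)) _ 0).
- by rewrite -EFinB sub0r opprK.
- by move=> x ax; rewrite mulr_ge0// invr_ge0 sqr_ge0.
- apply: continuous_in_subspaceT => x; rewrite inE/= in_itv/= andbT => ax.
  have x0 : x != 0 by rewrite gt_eqF// (lt_le_trans a0).
  apply: cvgM; first exact: cvg_cst.
  apply: cvgV; first by rewrite expf_neq0.
  exact: exprn_continuous.
- by rewrite -[X in _ --> X]oppr0 -[X in - X](mulr0 c); apply: cvgN; apply: cvgM;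
    [exact: cvg_cst|exact: cvgyV].
- by move=> x /dF [].
- apply: cvgN; apply: cvgM; first exact: cvg_cst.
  by apply: cvg_at_right_filter; apply: inv_continuous; rewrite gt_eqF.
- by move=> x; rewrite in_itv/= andbT => /dF ?; rewrite derive1E derive_val.
Qed.

Lemma sum_half_le1 (R : realType) (k : nat) : \sum_(i < k) 2^-1 ^+ i.+1 <= 1 :> R.
Proof.
suff -> : \sum_(i < k) 2^-1 ^+ i.+1 = 1 - 2^-1 ^+ k :> R.
  by rewrite gerBl exprn_ge0.
elim: k => [|k IH]; first by rewrite big_ord0 expr0 subrr.
by rewrite big_ord_recr/= IH exprS; field.
Qed.

(** Past any given bound, sublinearity supplies an integer meeting the [i]-th tolerance, so the
    sequence is built recursively, each value being chosen beyond the previous one. *)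
Lemma sublinear_sparse (R : realType) (h : R -> R) (e : nat -> R) :
  sublinear h -> (forall i, 0 < e i) ->
  exists n : nat -> nat, {homo n : i j / (i < j)%N} /\
    forall i, (0 < n i)%N /\ h (n i)%:R <= e i * (n i)%:R.
Proof.
move=> hsub e0.
(* The pair holds the index of the tolerance and the value to be exceeded. *)
have ex (iN : nat * nat) : exists m : nat,
    (iN.2 < m)%N /\ h m%:R <= e iN.1 * m%:R.
  have hn : h m%:R / m%:R @[m --> \oo] --> (0 : R).
    exact: (cvg_comp _ _ (@cvgr_idn R) hsub).
  have := @cvgr0_norm_le _ _ _ _ _ _ hn _ (e0 iN.1).
  move=> [M _ HM]; exists (maxn M iN.2.+1); split; first by rewrite leq_max ltnSn orbT.
  have := HM _ (leq_maxl M iN.2.+1) => /(le_trans (ler_norm _)).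
  by rewrite ler_pdivrMr// ltr0n leq_max orbT.
have [g Hg] := choice ex.
(* Starting from the bound 0 makes [n 0] positive. *)
pose n := fix n i := if i is j.+1 then g (i, n j) else g (0%N, 0%N).
exists n; split.
  by apply: homo_ltn => [? ? ?|i]; [exact: ltn_trans|have [] := Hg (i.+1, n i)].
move=> [|i]; first exact: Hg.
by have [lt_n le_h] := Hg (i.+1, n i); split; first exact: leq_ltn_trans lt_n.
Qed.

(* When [i <= n i] for all [i], the truncation at [truncn t] omits no [i] with
   [n i <= t]. *)
Definition step_sum (R : realType) (h : R -> R) (n : nat -> nat) (t : R) : R :=
  \sum_(i < (Num.truncn t).+1) (if (n i)%:R <= t then h (n i)%:R else 0).

Section StepSum.
Variables (R : realType) (h : R -> R) (n : nat -> nat).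
Hypothesis h0 : maps_nonneg h.
Hypothesis n_incr : {homo n : i j / (i < j)%N}.

Let term_ge0 (t : R) i : 0 <= (if (n i)%:R <= t then h (n i)%:R else 0).
Proof. by case: ifP => // _; exact: h0. Qed.

Lemma step_sum_ge0 t : 0 <= step_sum h n t.
Proof. by apply: sumr_ge0 => i _; exact: term_ge0. Qed.

(** Passing from [s] to [t] appends nonnegative terms and, among the old ones, can only turn a 0
    into [h (n i)]. *)
Lemma step_sum_nondecreasing : {homo step_sum h n : s t / s <= t}.
Proof.
move=> s t st; rewrite /step_sum.
rewrite -!(big_mkord xpredT (fun i => if (n i)%:R <= _ then h (n i)%:R else 0)).
rewrite [leRHS](big_cat_nat (n := (Num.truncn s).+1))//=; last first.
  by rewrite ltnS le_truncn.
rewrite -[leLHS]addr0 lerD ?sumr_ge0//.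
apply: ler_sum => i _; case: ifP => [/le_trans->//|_]; exact: term_ge0.
Qed.

(** Strict monotonicity gives [i <= n i], so the index [i] lies within the truncated range; the
    remaining terms are nonnegative. *)
Lemma le_step_sum i : h (n i)%:R <= step_sum h n (n i)%:R.
Proof.
have le_in : (i <= n i)%N.
  by elim: i => // i IH; rewrite (leq_ltn_trans IH)// n_incr.
have lt_i : (i < (Num.truncn ((n i)%:R : R)).+1)%N.
  by rewrite natrK ltnS.
rewrite /step_sum (bigD1 (Ordinal lt_i))//= lexx lerDl.
by apply: sumr_ge0 => j _; exact: term_ge0.
Qed.

Hypothesis h_small : forall i, h (n i)%:R <= 2^-1 ^+ i.+1 * (n i)%:R.

(** A nonzero term has [n i <= t], hence is at most [2^-(i+1) * t], and these weights sum to at most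
    1. *)
Lemma step_sum_le t : 0 <= t -> step_sum h n t <= t.
Proof.
move=> t0; rewrite -[leRHS]mul1r.
apply: (le_trans (y := (\sum_(i < (Num.truncn t).+1) 2^-1 ^+ i.+1) * t)).
  rewrite mulr_suml; apply: ler_sum => i _.
  case: ifP => [nit|_]; last by rewrite mulr_ge0// exprn_ge0.
  by apply: le_trans (h_small i) _; rewrite ler_wpM2l// exprn_ge0.
by rewrite ler_wpM2r// sum_half_le1.
Qed.

Hypothesis n_gt0 : forall i, (0 < n i)%N.

Lemma integral_step_sum :
  (\int[@lebesgue_measure R]_(t in `[1%R, +oo[)
     (step_sum h n t * t ^- 2)%:E < +oo)%E.
Proof.
set D := `[1%R, +oo[%classic.
have mD : measurable D by exact: measurable_itv.
have mV (a : R) : 0 < a -> measurable_fun `[a, +oo[ (fun t : R => t ^- 2).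
  by move=> a0; apply: measurable_fun_inv_sqr => //; exact: itvcy_pos.
have n_pos i : 0 < (n i)%:R :> R by rewrite ltr0n.
(* The share of index [i] in the integrand, extended by 0 to the left of [n i]. *)
pose u i := (fun t : R => (h (n i)%:R * t ^- 2)%:E) \_ `[(n i)%:R, +oo[.
have u0 i t : (0 <= u i t)%E.
  rewrite /u patchE; case: ifPn => // _.
  by rewrite lee_fin mulr_ge0 ?invr_ge0 ?sqr_ge0 ?h0.
have mu i : measurable_fun D (u i).
  apply/measurable_restrict => //.
  apply: measurable_funS (measurable_itv `[(n i)%:R, +oo[) _ _ => //.
  apply/measurable_EFinP; apply: measurable_funM => //; exact: mV.
(* The integrand is a partial sum of the nonnegative series of the [u i t], whose length depends on
   [t]; passing to the full series removes this dependence. *)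
have le_u t : D t -> ((step_sum h n t * t ^- 2)%:E <= \sum_(0 <= i <oo) u i t)%E.
  move=> _; apply: (@le_trans _ _ (\sum_(0 <= i < (Num.truncn t).+1) u i t)%E);
    last exact: nneseries_lim_ge.
  rewrite big_mkord /step_sum mulr_suml -sumEFin; apply: lee_sum => i _.
  rewrite /u patchE mem_setE in_itv/= andbT.
  by case: ifP => _; rewrite ?mul0r.
apply: (@le_lt_trans _ _ 1%E); last exact: ltry.
apply: (@le_trans _ _
    (\int[lebesgue_measure]_(t in D) \sum_(0 <= i <oo) u i t)%E).
  apply: ge0_le_integral => //.
  - by move=> t _; rewrite lee_fin mulr_ge0 ?step_sum_ge0// invr_ge0 sqr_ge0.
  - apply/measurable_EFinP; apply: measurable_funM; last exact: mV.
    by apply: nondecreasing_measurable => //; exact: step_sum_nondecreasing.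
  - by apply: (ge0_emeasurable_sum (P := xpredT)) => [i t _ _|i _]; [exact: u0|exact: mu].
(* Nonnegativity allows exchanging sum and integral; it then suffices to bound every partial sum by
   1. *)
rewrite integral_nneseries//.
apply: lime_le.
  by apply: is_cvg_nneseries => i _ _; apply: integral_ge0 => t _; exact: u0.
apply: nearW => k; rewrite big_mkord.
apply: le_trans (_ : (\sum_(i < k) (2^-1 ^+ i.+1)%:E <= 1)%E); last first.
  by rewrite sumEFin lee_fin sum_half_le1.
apply: lee_sum => i _.
(* As [n i >= 1], the support of [u i] lies in [D], and its integral is [h (n i) / n i]. *)
rewrite /u -integral_mkcondr setIidr; last first.
  move=> t; rewrite /D/= !in_itv/= !andbT; apply: le_trans.
  by rewrite ler1n.
rewrite integral_itvcy_inv_sqr ?h0//.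
by rewrite lee_fin ler_pdivrMr.
Qed.

End StepSum.

Theorem proposition8 (R : realType) (h : R -> R) (p : R) :
  maps_nonneg h -> increasing_nonneg h -> sublinear h -> 1 <= p ->
  exists f : R -> R,
    [/\ maps_nonneg f,
        nondecreasing_nonneg f,
        (\int[@lebesgue_measure R]_(t in `[1%R, +oo[)
           ((f t / t) `^ p / t)%:E < +oo)%E
      & exists c : R, 0 < c /\
        exists n : nat -> nat,
          (forall i j : nat, (i < j)%N -> (n i < n j)%N) /\
          (forall i : nat, c * h (n i)%:R <= f (n i)%:R)].
Proof.
move=> h0 _ hsub p1.
(* These tolerances have sum at most 1, which serves twice: for [f t / t <= 1] and for the integral
   bound. *)
have half_gt0 i : 0 < 2^-1 ^+ i.+1 :> R by rewrite exprn_gt0.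
have [n [n_incr /all_and2[n_gt0 h_small]]] := sublinear_sparse hsub half_gt0.
exists (step_sum h n); split.
- by move=> t _; exact: step_sum_ge0.
- by move=> s t _; exact: step_sum_nondecreasing.
- apply: le_lt_trans (integral_step_sum h0 h_small n_gt0).
  set D := `[1%R, +oo[%classic.
  have mD : measurable D by exact: measurable_itv.
  have mf : measurable_fun D (step_sum h n).
    by apply: nondecreasing_measurable => //; exact: step_sum_nondecreasing.
  have mV : measurable_fun D (fun t : R => t^-1).
    by apply: measurable_fun_inv => //; exact: itvcy_pos.
  have quot_ge0 (t : R) : 1 <= t -> 0 <= step_sum h n t / t.
    by move=> t1; rewrite divr_ge0 ?step_sum_ge0// (le_trans ler01).
  apply: ge0_le_integral => //.
  + move=> t; rewrite /D/= in_itv/= andbT => t1.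
    by rewrite lee_fin divr_ge0 ?powR_ge0// (le_trans ler01).
  + apply/measurable_EFinP; apply: measurable_funM => //.
    apply: (@measurableT_comp _ _ _ _ _ _ (@powR R ^~ p)).
      exact: measurable_powR.
    exact: measurable_funM.
  + apply/measurable_EFinP; apply: measurable_funM => //.
    by apply: measurable_fun_inv_sqr => //; exact: itvcy_pos.
  + move=> t; rewrite /D/= in_itv/= andbT => t1.
    have t0 : 0 < t by exact: lt_le_trans t1.
    rewrite lee_fin -exprVn expr2 mulrA ler_pM2r ?invr_gt0//.
    (* With [q = f t / t], the claim is [q^p <= q]. The case [q = 0] is separate and uses that [p]
       is nonzero; otherwise [0 < q <= 1] and [p >= 1] give it. *)
    have := quot_ge0 _ t1; rewrite le_eqVlt => /predU1P[<-|q0].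
      by rewrite powR0// gt_eqF// (lt_le_trans ltr01).
    apply: ge1r_powR => //.
    by rewrite q0 ler_pdivrMr// mul1r step_sum_le// ltW.
- exists 1; split=> //; exists n; split=> [//|i].
  by rewrite mul1r le_step_sum.
Qed.
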